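(* Let $F$ be an ordered field and consider Klein's model over $F$ in dimension 2: points are vectors $p \in F^2$ with $p \cdot p < 1$ (where $\cdot$ is the standard dot product); for points $a,b,c$, the betweenness $\beta(a,b,c)$ holds iff there exists $k \in F$ with $0 \le k \le 1$ and $b - a = k\,(c-a)$; and segments $ab$, $cd$ are congruent iff $$\frac{(1 - a\cdot b)^2}{(1 - a\cdot a)(1 - b\cdot b)} = \frac{(1 - c\cdot d)^2}{(1 - c\cdot c)(1 - d\cdot d)}.$$ Then the following axiom (Proclus' postulate) does not hold in this model: for all points $A,B,C,D,P,Q$, if $\mathrm{Par}(A,B,C,D)$, $\mathrm{Col}(A,B,P)$ and $\lnot\mathrm{Col}(A,B,Q)$, then there exists a point $Y$ with $\mathrm{Col}(C,D,Y)$ and $\mathrm{Col}(P,Q,Y)$.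
   Context: All points below range over the points of the model (vectors strictly inside the unit disk). $\mathrm{Col}(A,B,C)$ holds iff $\beta(A,B,C) \lor \beta(B,C,A) \lor \beta(C,A,B)$. $\mathrm{Coplanar}(A,B,C,D)$ holds iff there is a point $X$ with $(\mathrm{Col}(A,B,X)\land \mathrm{Col}(C,D,X)) \lor (\mathrm{Col}(A,C,X)\land \mathrm{Col}(B,D,X)) \lor (\mathrm{Col}(A,D,X)\land \mathrm{Col}(B,C,X))$. $\mathrm{Par}(A,B,C,D)$ holds iff either ($A \neq B$, $C \neq D$, $\mathrm{Coplanar}(A,B,C,D)$, and there is no point $X$ with $\mathrm{Col}(X,A,B)$ and $\mathrm{Col}(X,C,D)$), or ($A \neq B$, $C \neq D$, $\mathrm{Col}(A,C,D)$ and $\mathrm{Col}(B,C,D)$). *)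

(* Defs.v *)
From HB Require Import structures.
From mathcomp Require Import all_boot all_order all_algebra.

Set Implicit Arguments.
Unset Strict Implicit.
Unset Printing Implicit Defensive.

Import Order.TTheory GRing.Theory Num.Theory.
Local Open Scope ring_scope.

(* A structure for the language of Tarski's geometry; no axiom is imposed. *)
Record tarski_structure := TarskiStructure {
  point : Type;
  bet : point -> point -> point -> Prop;
  cong : point -> point -> point -> point -> Prop
}.

Section Notions.
Variable T : tarski_structure.
Implicit Types A B C D P Q X Y : point T.

Definition col A B C : Prop := bet A B C \/ bet B C A \/ bet C A B.

Definition coplanar A B C D : Prop :=
  exists X, (col A B X /\ col C D X) \/
            (col A C X /\ col B D X) \/
            (col A D X /\ col B C X).

Definition par_strict A B C D : Prop :=
  [/\ A <> B, C <> D, coplanar A B C D & ~ exists X, col X A B /\ col X C D].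

Definition par A B C D : Prop :=
  par_strict A B C D \/ [/\ A <> B, C <> D, col A C D & col B C D].

Definition proclus_postulate : Prop :=
  forall A B C D P Q, par A B C D -> col A B P -> ~ col A B Q ->
    exists Y, col C D Y /\ col P Q Y.

End Notions.

Section Klein.
Variable F : realFieldType.

Definition dot (u v : 'rV[F]_2) : F := \sum_(i < 2) u 0 i * v 0 i.

Definition klein_point : Type := {p : 'rV[F]_2 | dot p p < 1}.

Definition klein_bet (a b c : klein_point) : Prop :=
  exists k : F, 0 <= k <= 1 /\ val b - val a = k *: (val c - val a).

(* The denominator is nonzero, as dot (val a) (val a) < 1 for every point. *)
Definition klein_ratio (a b : klein_point) : F :=
  (1 - dot (val a) (val b)) ^+ 2 /
  ((1 - dot (val a) (val a)) * (1 - dot (val b) (val b))).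

Definition klein_cong (a b c d : klein_point) : Prop :=
  klein_ratio a b = klein_ratio c d.

Definition klein_model : tarski_structure :=
  TarskiStructure klein_bet klein_cong.

End Klein.

(* Main.v *)
(* The lines y = 1/2 and x + 4y = 2 both pass through (0, 1/2), and both miss
   the line y = 0 inside the disk: the first is parallel to it in the affine
   plane, the second crosses it at (2, 0), outside the disk. *)
Require Import Defs.
From mathcomp Require Import all_boot all_order all_algebra.
From mathcomp Require Import ring lra.

Set Implicit Arguments.
Unset Strict Implicit.
Unset Printing Implicit Defensive.

Import Order.TTheory GRing.Theory Num.Theory.
Local Open Scope ring_scope.

Section KleinCoordinates.
Variable F : realFieldType.
Implicit Types a b c p : klein_point F.

Definition xcoord p : F := val p 0 0.
Definition ycoord p : F := val p 0 1.

(** This bound is what rules out a meeting point of two lines that exists only in the affine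
    plane. *)
Lemma klein_point_bound p : xcoord p * xcoord p + ycoord p * ycoord p < 1.
Proof.
have := proj2_sig p; rewrite /dot big_ord_recl big_ord1.
by have -> : lift ord0 ord0 = 1 :> 'I_2 by apply: val_inj.
Qed.

Lemma klein_point_exists (x y : F) :
  x * x + y * y < 1 -> exists p, xcoord p = x /\ ycoord p = y.
Proof.
move=> xy_lt1; pose v : 'rV[F]_2 := \row_i (if i == 0 then x else y).
have v_lt1 : dot v v < 1 by rewrite /dot big_ord_recl big_ord1 !mxE.
by exists (exist _ v v_lt1); rewrite /xcoord /ycoord /= !mxE.
Qed.

Lemma klein_betE a b c :
  klein_bet a b c <-> exists k : F, [/\ 0 <= k <= 1,
    xcoord b - xcoord a = k * (xcoord c - xcoord a) &
    ycoord b - ycoord a = k * (ycoord c - ycoord a)].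
Proof.
split=> -[k]; last first.
  move=> [k01 ex ey]; exists k; split=> //; apply/rowP=> i; rewrite !mxE.
  case: i => [[|[|//]] lti].
    by have -> : Ordinal lti = 0 by apply: val_inj.
  by have -> : Ordinal lti = 1 by apply: val_inj.
move=> [k01 /rowP e]; exists k; split=> //.
  by have := e 0; rewrite !mxE.
by have := e 1; rewrite !mxE.
Qed.

(** Each betweenness makes one point an affine combination of the other two, so the determinant of
    [b - a] and [c - a] vanishes; the range of [k] is irrelevant. With two of the points known, the
    equation is linear in the third. *)
Lemma klein_col_det a b c : @Defs.col (klein_model F) a b c ->
  (xcoord b - xcoord a) * (ycoord c - ycoord a) =
  (ycoord b - ycoord a) * (xcoord c - xcoord a).
Proof.
case=> [|[]] /klein_betE[k [_ ex ey]].
- by rewrite ex ey; ring.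
- have -> : xcoord b - xcoord a = (xcoord c - xcoord a) - (xcoord c - xcoord b)
    by ring.
  have -> : ycoord b - ycoord a = (ycoord c - ycoord a) - (ycoord c - ycoord b)
    by ring.
  rewrite ex ey.
  have -> : xcoord c = xcoord b + k * (xcoord a - xcoord b) by rewrite -ex; ring.
  have -> : ycoord c = ycoord b + k * (ycoord a - ycoord b) by rewrite -ey; ring.
  by ring.
- have -> : xcoord a = xcoord c + k * (xcoord b - xcoord c) by rewrite -ex; ring.
  have -> : ycoord a = ycoord c + k * (ycoord b - ycoord c) by rewrite -ey; ring.
  by ring.
Qed.

End KleinCoordinates.

Theorem theorem1 (F : realFieldType) : ~ proclus_postulate (klein_model F).
Proof.
have [|A [Ax Ay]] := @klein_point_exists F 0 (1 / 2); first by lra.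
have [|B [Bx By]] := @klein_point_exists F (1 / 2) (1 / 2); first by lra.
have [|C [Cx Cy]] := @klein_point_exists F 0 0; first by lra.
have [|D [Dx Dy]] := @klein_point_exists F (1 / 2) 0; first by lra.
(* A second point of x + 4y = 2, so that [A] and [Q] span this line. *)
have [|Q [Qx Qy]] := @klein_point_exists F (1 / 2) (3 / 8); first by lra.
(* The common midpoint of [A D] and [B C], the diagonals of a square; it witnesses coplanarity. *)
have [|M [Mx My]] := @klein_point_exists F (1 / 4) (1 / 4); first by lra.
move=> /(_ A B C D A Q) [||/klein_col_det|Y].
- left; split.
  + by move=> AB; move: Ax; rewrite AB Bx; lra.
  + by move=> CD; move: Cx; rewrite CD Dx; lra.
  + exists M; right; right; split; right; left; apply/klein_betE; exists (1 / 2);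
      rewrite ?Ax ?Ay ?Bx ?By ?Cx ?Cy ?Dx ?Dy ?Mx ?My; split; lra.
  (* The products of coordinates of [X] cancel, leaving y = 1/2 and y = 0. *)
  + move=> [X [/klein_col_det + /klein_col_det]].
    rewrite Ax Ay Bx By Cx Cy Dx Dy; lra.
- right; right; apply/klein_betE; exists 0.
  by rewrite Ax Ay Bx By; split; lra.
- by rewrite Ax Ay Bx By Qx Qy; lra.
- move=> [/klein_col_det + /klein_col_det].
  rewrite Ax Ay Cx Cy Dx Dy Qx Qy => eCD eAQ.
  (* [eCD] reduces to y = 0 and [eAQ] to x + 4y = 2, which forces [Y] to be (2, 0). *)
  have y0 : ycoord Y = 0 by lra.
  have x2 : xcoord Y = 2 by lra.
  by have := klein_point_bound Y; rewrite x2 y0; lra.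
Qed.
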